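(* Let $G=(V,E)$ be an unweighted graph with maximum degree $d_G$ and treewidth $w_G$. Then the ER density of $G$ is $(w_Gd_G)^{O(w_Gd_G^3)}$. In particular, a graph with constant maximum degree and constant treewidth has constant ER density.
   Context: Edges have unit conductance; $R(u,v)=(\mathbf{1}_u-\mathbf{1}_v)^TL^+(\mathbf{1}_u-\mathbf{1}_v)$ is the effective resistance ($L$ the Laplacian, $L^+$ its pseudoinverse). The unit ER ball of $v$ is $B_R(v)=\{u\in V:R(u,v)\le 1\}$ and the ER density is $\rho_R(G)=\max_{v\in V}|B_R(v)|$.
   Formalization: The bound is stated for w_G d_G ≠ 1 (a single edge has density 2, but the bound would be 1), and the unit ER ball of v contains only vertices in v's connected component (resistance between components is infinite), since the literal L^+ formula fails for disconnected graphs. *)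

(* Defs.v *)
From mathcomp Require Import all_boot all_order all_algebra.
From mathcomp Require Import boolp reals.

Set Implicit Arguments.
Unset Strict Implicit.
Unset Printing Implicit Defensive.

Import Order.TTheory GRing.Theory Num.Theory.
Local Open Scope ring_scope.

Section Pseudoinverse.
Variable R : realFieldType.

(* The four Penrose conditions; over a real field the adjoint is the transpose. *)
Definition penrose m n (A : 'M[R]_(m, n)) (X : 'M[R]_(n, m)) : bool :=
  [&& A *m X *m A == A, X *m A *m X == X,
      (A *m X)^T == A *m X & (X *m A)^T == X *m A].

Lemma gram_unitmx m n (B : 'M[R]_(m, n)) : row_free B -> B *m B^T \in unitmx.
Proof.
move=> freeB; rewrite -row_free_unit; apply/row_freeP.
suff /eqP kB0 : kermx (B *m B^T) == 0.
  by apply/row_freeP; rewrite -kermx_eq0 kB0.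
rewrite -(mulmx_free_eq0 _ freeB); set Y := _ *m B.
have YYT : Y *m Y^T = 0.
  by rewrite /Y trmx_mul !mulmxA -[_ *m B *m B^T]mulmxA mulmx_ker mul0mx.
apply/eqP/matrixP => i j; rewrite [RHS]mxE.
have /matrixP/(_ i i) := YYT; rewrite 2!mxE => /eqP.
under eq_bigr => k _ do rewrite [Y^T k i]mxE -expr2.
rewrite psumr_eq0 => [/allP/(_ j)|k _]; last exact: sqr_ge0.
by rewrite mem_index_enum sqrf_eq0 => /(_ isT) /eqP.
Qed.

Lemma penrose_exists m n (A : 'M[R]_(m, n)) : exists X, penrose A X.
Proof.
have := row_base_free A; have := col_base_full A; have := mulmx_base A.
move: (row_base A) (col_base A); move: (\rank A) => r B C <- fullC freeB.
have uB : B *m B^T \in unitmx by exact: gram_unitmx.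
have uC : C^T *m C \in unitmx.
  by rewrite -{2}[C]trmxK; apply: gram_unitmx; rewrite /row_free mxrank_tr.
pose X := B^T *m invmx (B *m B^T) *m (invmx (C^T *m C) *m C^T).
have AX : C *m B *m X = C *m invmx (C^T *m C) *m C^T.
  by rewrite /X !mulmxA -[C *m B *m B^T]mulmxA mulmxK.
have XA : X *m (C *m B) = B^T *m invmx (B *m B^T) *m B.
  rewrite /X -!mulmxA; do 2 congr (_ *m _).
  by rewrite [C^T *m (_ *m _)]mulmxA mulKmx.
exists X; apply/and4P; split; apply/eqP.
- by rewrite AX !mulmxA -[_ *m C^T *m C]mulmxA mulmxKV.
- by rewrite XA /X !mulmxA -[_ *m B *m B^T]mulmxA mulmxKV.
- by rewrite AX !trmx_mul trmx_inv trmx_mul !trmxK mulmxA.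
- by rewrite XA !trmx_mul trmx_inv trmx_mul !trmxK mulmxA.
Qed.

Lemma penrose_unique m n (A : 'M[R]_(m, n)) X Y :
  penrose A X -> penrose A Y -> X = Y.
Proof.
move=> /and4P[/eqP X1 /eqP X2 /eqP X3 /eqP X4].
move=> /and4P[/eqP Y1 /eqP Y2 /eqP Y3 /eqP Y4].
have AXY : A *m X = A *m Y.
  rewrite -X3 -{1}Y1 -[A *m Y *m A *m X]mulmxA trmx_mul X3 Y3.
  by rewrite mulmxA X1.
have XAY : X *m A = Y *m A.
  rewrite -X4 -{1}Y1 -[A *m Y *m A]mulmxA [X *m _]mulmxA trmx_mul X4 Y4.
  by rewrite -mulmxA [A *m (X *m A)]mulmxA X1.
by rewrite -X2 -mulmxA AXY mulmxA XAY Y2.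
Qed.

(* Moore-Penrose pseudoinverse (mathcomp's pinvmx is only a one-sided
   generalized inverse). *)
Definition mpinv m n (A : 'M[R]_(m, n)) : 'M[R]_(n, m) :=
  xchoose (penrose_exists A).

Lemma mpinvP m n (A : 'M[R]_(m, n)) : penrose A (mpinv A).
Proof. exact: xchooseP. Qed.

End Pseudoinverse.

Record sgraph := SGraph {
  vertex :> finType;
  edge : rel vertex;
  edge_sym : symmetric edge;
  edge_irr : irreflexive edge }.

Definition degree (G : sgraph) (v : G) : nat := #|[set u | edge v u]|.

Definition max_degree (G : sgraph) : nat := \max_(v : G) degree v.

(* The clause on c excludes simple cycles of length at least 3; a 2-element
   ucycle is just an edge traversed back and forth. *)
Definition is_tree (T : sgraph) : Prop :=
  [/\ (0 < #|T|)%N,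
      forall s t : T, connect (@edge T) s t
    & forall c : seq T, (2 < size c)%N -> ~ ucycle (@edge T) c].

Definition is_tree_decomposition (G T : sgraph) (B : T -> {set G}) : Prop :=
  [/\ is_tree T,
      forall v : G, exists t, v \in B t,
      forall u v : G, edge u v -> exists t, (u \in B t) && (v \in B t)
    & forall (v : G) (s t : T), v \in B s -> v \in B t ->
        connect [rel x y | [&& edge x y, v \in B x & v \in B y]] s t].

(* Largest bag size minus one.  The predecessor only truncates for the graph
   without vertices, which thus gets treewidth 0 rather than -1. *)
Definition td_width (G T : sgraph) (B : T -> {set G}) : nat :=
  (\max_(t : T) #|B t|).-1.

Definition has_td_of_width (G : sgraph) (k : nat) : Prop :=
  exists (T : sgraph) (B : T -> {set G}),
    is_tree_decomposition B /\ td_width B = k.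

Lemma has_td (G : sgraph) : exists k, `[< has_td_of_width G k >].
Proof.
pose T := @SGraph unit (fun _ _ => false) (fun _ _ => erefl) (fun _ => erefl).
pose B (t : T) := [set: G].
exists (td_width B); apply/asboolP; exists T, B; split=> //; split.
- split=> [|[] []|[|[] [|[] c]] //]; first by rewrite card_unit.
  exact: connect0.
- by move=> v; exists tt; rewrite inE.
- by move=> u v _; exists tt; rewrite !inE.
- by move=> v [] [] _ _; apply: connect0.
Qed.

Definition treewidth (G : sgraph) : nat := ex_minn (has_td G).

Section EffectiveResistance.
Variables (R : realType) (G : sgraph).

(* Rows and columns are indexed by vertices through enum_val / enum_rank. *)
Definition laplacian : 'M[R]_#|G| :=
  \matrix_(i, j) ((degree (enum_val i))%:R *+ (i == j)
                  - (edge (enum_val i) (enum_val j))%:R).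

Definition indicator (v : G) : 'cV[R]_#|G| := delta_mx (enum_rank v) 0.

Definition eff_res (u v : G) : R :=
  ((indicator u - indicator v)^T *m mpinv laplacian
     *m (indicator u - indicator v)) 0 0.

(* The quadratic form is the effective resistance only inside a connected
   component; between different components the effective resistance is
   infinite (the quadratic form is finite there), so such vertices are not in
   the ball.  For connected G the first condition is vacuous. *)
Definition er_ball (v : G) : {set G} :=
  [set u | connect (@edge G) u v && (eff_res u v <= 1)].

Definition er_density : nat := \max_(v : G) #|er_ball v|.

End EffectiveResistance.

(* Main.v *)
(** Let b be one more than the treewidth, d the maximum degree and m = 2bd.
    Inside a tree decomposition, any set N of vertices extends to a set U of
    at most 2b|N| vertices such that each component of G - U has at most 2b
    neighbours: close the tree nodes carrying N under medians, so that each
    component left in the tree touches at most two chosen bags.  Starting from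
    the unit ball of v, discard at each level the inner boundary N of the
    current region together with U, and keep the component richest in ball
    vertices.  Each level costs a factor polynomial in bd and yields an edge cut
    of size at most m, disjoint from the earlier ones.  A ball too large would
    leave a ball vertex u behind m + 1 such cuts; the potential counting them
    is m + 1 at u, 0 at v and has energy at most m (m + 1), whence R(u, v) > 1
    (the Nash-Williams inequality). *)

Require Import Defs.
From mathcomp Require Import all_boot all_order all_algebra.
From mathcomp Require Import boolp reals.
From mathcomp Require Import zify ring lra.

Set Implicit Arguments.
Unset Strict Implicit.
Unset Printing Implicit Defensive.

Import Order.TTheory GRing.Theory Num.Theory.

(** * Cardinalities and reachability in finite sets *)

Section FiniteSets.

Lemma card_bigcup_le (I T : finType) (P : {pred I}) (F : I -> {set T}) n :
  (forall i, i \in P -> #|F i| <= n) -> #|\bigcup_(i in P) F i| <= #|P| * n.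
Proof.
move=> leF; rewrite -sum_nat_const.
apply: (@leq_trans (\sum_(i in P) #|F i|)); last exact: leq_sum.
elim/big_rec2: _ => [|i k A _ leAk]; first by rewrite cards0.
by rewrite (leq_trans (leq_card_setU _ _)) // leq_add2l.
Qed.

Lemma card_le1_set (T : finType) (A : {set T}) :
  (forall x y, x \in A -> y \in A -> x = y) -> #|A| <= 1.
Proof.
move=> A1; have [->|[x xA]] := set_0Vmem A; first by rewrite cards0.
by rewrite -(cards1 x) subset_leq_card //; apply/subsetP => y /A1/(_ xA)->; rewrite inE.
Qed.

Lemma card_le2_sub (T : finType) (A : {set T}) :
  A != set0 -> #|A| <= 2 ->
  exists x y, [/\ x \in A, y \in A & A \subset [set x; y]].
Proof.
move=> /set0Pn[x xA]; rewrite (cardsD1 x) xA ltnS => leA.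
have [A0|[y yA]] := set_0Vmem (A :\ x).
  exists x, x; split=> //; apply/subsetP => z zA.
  by have := in_set0 z; rewrite -A0 !inE zA andbT => /negbFE/eqP->; rewrite eqxx.
have /andP[_ yA'] : (y != x) && (y \in A) by move: yA; rewrite !inE.
exists x, y; split=> //; apply/subsetP => z zA; rewrite !inE.
case: eqVneq => //= zx; apply/eqP.
move: leA; rewrite (cardsD1 y) yA ltnS leqn0 cards_eq0 => /eqP/setP/(_ z).
by rewrite !inE zx zA !andbT => /negbFE/eqP.
Qed.

Lemma connect_first_entry (T : finType) (e : rel T) (A : {set T}) x y :
  connect e x y -> x \notin A -> y \in A ->
  exists z z', [/\ connect [rel s t | [&& e s t, s \notin A & t \notin A]] x z,
                   e z z', z \notin A & z' \in A].
Proof.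
move=> /connectP[p]; elim: p x => [|z p IHp] x /=.
  by move=> _ -> /negP.
case/andP=> exz pz def_y xA yA; have [zA|zA] := boolP (z \in A).
  by exists x, z; split.
have [s [s' [czs ess' sA s'A]]] := IHp z pz def_y zA yA.
exists s, s'; split=> //; apply: connect_trans czs.
by apply: connect1; rewrite /= exz xA zA.
Qed.

Lemma connect_closed (T : finType) (e : rel T) (P : {pred T}) x y :
  (forall s t, e s t -> s \in P -> t \in P) -> connect e x y -> x \in P -> y \in P.
Proof.
move=> clP /connectP[p]; elim: p x => [|z p IHp] x /=; first by move=> _ ->.
by case/andP=> exz pz def_y xP; apply: (IHp z) => //; apply: clP xP.
Qed.

End FiniteSets.

(** * Components after deleting a set of vertices *)

Section Avoiding.
Variable G : sgraph.
Implicit Types (A U M : {set G}) (x y z : G).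

(** Deleting [U] only cuts edges: the vertices of [U] stay in the type, as isolated points. *)
Definition avoid U : rel G := [rel x y | [&& edge x y, x \notin U & y \notin U]].

Lemma avoid_sym U : connect_sym (avoid U).
Proof.
by apply: sym_connect_sym => x y; rewrite /avoid /= edge_sym [(x \notin U) && _]andbC.
Qed.

Lemma avoid_sub U U' x y :
  U' \subset U -> connect (avoid U) x y -> connect (avoid U') x y.
Proof.
move=> sU; apply: connect_sub => s t /= /and3P[est sNU tNU].
by apply: connect1; rewrite /avoid /= est !(contraNN (subsetP sU _)).
Qed.

Lemma avoid_notin U x y : connect (avoid U) x y -> x \notin U -> y \notin U.
Proof.
move=> cxy xU; apply: (connect_closed (P := [pred z | z \notin U]) _ cxy xU).
by move=> s t /= /and3P[].
Qed.

Lemma avoid_step U x y z :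
  connect (avoid U) x y -> edge y z -> y \notin U -> z \notin U ->
  connect (avoid U) x z.
Proof.
by move=> cxy eyz yU zU; apply: connect_trans cxy (connect1 _); rewrite /avoid /= eyz yU zU.
Qed.

Definition comp U x : {set G} := [set y | connect (avoid U) x y].

(** For [x] outside [U], this is the neighbourhood of the component of [x] in G - U. *)
Definition attach U x : {set G} :=
  [set u in U | [exists y, connect (avoid U) x y && edge y u]].

Lemma attachP U x u :
  reflect (u \in U /\ exists2 y, connect (avoid U) x y & edge y u)
          (u \in attach U x).
Proof.
rewrite inE; apply: (iffP andP) => [[uU /existsP[y /andP[cxy eyu]]]|[uU [y cxy eyu]]].
  by split=> //; exists y.
by split=> //; apply/existsP; exists y; rewrite cxy.
Qed.

End Avoiding.

(** * Medians and thin node sets in a tree *)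

Section Trees.
Variable T : sgraph.
Hypothesis connT : forall s t : T, connect (@edge T) s t.
Hypothesis acycT : forall c : seq T, 2 < size c -> ~ ucycle (@edge T) c.
Implicit Types (M : {set T}) (q x y : T).

(** Otherwise a simple path from [x] to [y] avoiding [q] closes up through [q] to a cycle of length
    at least 3. *)
Lemma acyclic_neighbor q x y :
  edge q x -> edge q y -> connect (avoid [set q]) x y -> x = y.
Proof.
move=> eqx eqy /connectP[p0 /shortenP[p pth_p Up _] def_y].
have [//|xy] := eqVneq x y.
have xNq : x != q by apply: contraTneq eqx => ->; rewrite edge_irr.
have [pth qp] : path (@edge T) x p /\ q \notin p.
  elim: p x pth_p {eqx Up def_y xy xNq} => [|z p IHp] x //= /andP[/and3P[exz _ zq]].
  move=> /IHp[pz qp]; move: zq; rewrite !inE negb_or eq_sym exz pz qp andbT.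
  by move=> ->.
case: (@acycT (q :: x :: p)).
  by case: p def_y {pth_p Up pth qp} => //= yx; rewrite yx eqxx in xy.
rewrite /ucycle /= rcons_path pth eqx -def_y edge_sym eqy /=.
by rewrite inE negb_or eq_sym xNq qp; move: Up => /= ->.
Qed.

(** For three points, such a [q] is their median. It may be one of them, since deleting [q] leaves
    it isolated; a sequence lets points coincide. *)
Definition separates q (s : seq T) :=
  {in s &, forall x y, connect (avoid [set q]) x y -> x = y}.

(* Walk from q into the component of T - q holding two points of s; since at
   most one further point lies outside, these components shrink strictly. *)
Lemma exists_median (s : seq T) : 0 < #|T| -> size s <= 3 -> exists q, separates q s.
Proof.
move=> /card_gt0P[q0 _] s3.
pose good q := [forall x in s, forall y in s, connect (avoid [set q]) x y ==> (x == y)].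
have goodP q : reflect (separates q s) (good q).
  apply: (iffP idP) => [/forall_inP gq x y xs ys cxy|sep].
    by have /forall_inP/(_ _ ys)/implyP/(_ cxy)/eqP := gq x xs.
  apply/forall_inP => x xs; apply/forall_inP => y ys; apply/implyP => cxy.
  by apply/eqP; apply: sep.
have badP q : ~~ good q ->
    exists x y, [/\ x \in s, y \in s, x != y & connect (avoid [set q]) x y].
  case/forall_inPn => x xs /forall_inPn[y ys]; rewrite negb_imply => /andP[cxy xy].
  by exists x, y.
suff main n q x y : #|comp [set q] x| <= n -> x \in s -> y \in s -> x != y ->
    connect (avoid [set q]) x y -> exists q', separates q' s.
  have [/goodP|/badP[x [y [xs ys xy cxy]]]] := boolP (good q0); first by exists q0.
  exact: (@main _ q0 x y (leqnn _)).
elim: n q x y => [|n IHn] q x y leK xs ys xy cxy.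
  by move: leK; rewrite leqn0 cards_eq0 => /eqP/setP/(_ x); rewrite !inE connect0.
have xq : x \notin [set q].
  move: cxy => /connectP[[|z p]] /=; first by move=> _ yx; rewrite yx eqxx in xy.
  by case/andP=> /and3P[].
have [q' [q'' [cxq' eq'q q'q]]] := connect_first_entry (connT x q) xq (set11 q).
rewrite inE => /eqP def_q; rewrite {q''}def_q in eq'q.
have [/goodP|/badP[x' [y' [x's y's x'y' cx'y']]]] := boolP (good q'); first by exists q'.
(* The only edge from the component K of [x] to [q] starts at [q'], by acyclicity; so a walk
   avoiding [q'] cannot leave K. *)
have clK a b : connect (avoid [set q']) a b -> a \in comp [set q] x ->
    a != q' -> (b \in comp [set q] x) && (b != q').
  move=> cab aK aq'.
  apply: (connect_closed (P := [pred z | (z \in comp [set q] x) && (z != q')]) _ cab).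
    move=> z z' /and3P[ezz']; rewrite !inE => zq' z'q' /andP[cxz _].
    rewrite z'q' andbT; have zq := avoid_notin cxz xq.
    have [z'q|z'q] := eqVneq z' q; last by apply: avoid_step cxz ezz' zq _; rewrite inE.
    case/eqP: zq'; apply: (@acyclic_neighbor q).
    - by rewrite edge_sym -z'q.
    - by rewrite edge_sym.
    - by apply: connect_trans _ cxq'; rewrite avoid_sym.
  by rewrite inE aK aq'.
have x'q' : x' \notin [set q'].
  move: cx'y' => /connectP[[|z p]] /=; first by move=> _ yx; rewrite yx eqxx in x'y'.
  by case/andP=> /and3P[].
have y'q' := avoid_notin cx'y' x'q'.
(* If [y'] is in K, then so is [x'] by [clK]. If neither is, then [x], [y], [x'], [y'] are four
   distinct members of [s]. *)
have x'K : x' \in comp [set q] x.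
  have xK : x \in comp [set q] x by rewrite inE connect0.
  have yK : y \in comp [set q] x by rewrite inE.
  have [//|x'K] := boolP (x' \in comp [set q] x).
  have [y'K|y'K] := boolP (y' \in comp [set q] x).
    rewrite avoid_sym in cx'y'; rewrite inE in y'q'.
    by have /andP[] := clK _ _ cx'y' y'K y'q'; rewrite (negPf x'K).
  have : uniq [:: x; y; x'; y'].
    have neq a b : a \in comp [set q] x -> b \notin comp [set q] x -> a != b.
      by move=> aK; apply: contraNneq => <-.
    by rewrite /= !inE !negb_or xy x'y' !neq.
  move=> uniq4; have sub4 : {subset [:: x; y; x'; y'] <= s}; last first.
    by have := leq_trans (uniq_leq_size uniq4 sub4) s3.
  by move=> z; rewrite !inE => /or4P[]/eqP->.
apply: (IHn q' x' y') => //; rewrite -ltnS; apply: leq_trans leK; apply: proper_card.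
rewrite inE in x'q'; apply/properP; split.
  by apply/subsetP => z; rewrite inE => /clK/(_ x'K x'q')/andP[].
exists q'; first by rewrite inE.
by apply/negP; rewrite inE => /clK/(_ x'K x'q')/andP[_]; rewrite eqxx.
Qed.

Definition thin M := forall x, x \notin M -> #|attach M x| <= 2.

(** Add [p] together with a median [q] of [p] and the at most two attachments of its component. The
    pieces of that component then attach to [q] and at most one further node. *)
Lemma thin_add M p : 0 < #|T| -> thin M ->
  exists M', [/\ M \subset M', p \in M', #|M'| <= #|M| + 2 & thin M'].
Proof.
move=> T0 thinM; have [pM|pM] := boolP (p \in M).
  by exists M; split=> //; rewrite leq_addr.
have [q [m1 [m2 [sub_att sep_q qK]]]] : exists q m1 m2,
    [/\ attach M p \subset [set m1; m2], separates q [:: p; m1; m2]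
      & q \notin M -> connect (avoid M) p q].
  have [att0|att_n0] := eqVneq (attach M p) set0.
    exists p, p, p; split; rewrite ?att0 ?sub0set //.
    by move=> x y; rewrite !inE !orbb => /eqP-> /eqP->.
  have [m1 [m2 [m1a m2a sub_a]]] := card_le2_sub att_n0 (thinM _ pM).
  have [q sep_q] := @exists_median [:: p; m1; m2] T0 isT.
  (* A median outside both [M] and the component of [p] would leave [p] connected to [m1], forcing
     [p = m1], which lies in [M]. *)
  exists q, m1, m2; split=> // qM; apply: contraPT isT => npq _.
  have [m1M [y cpy eym1]] := attachP _ _ _ m1a.
  have yM := avoid_notin cpy pM.
  have /sep_q : connect (avoid [set q]) p m1.
    apply: (avoid_step (y := y)) => //; rewrite ?inE; last 2 first.
    - by apply: contraNneq npq => <-.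
    - by apply: contraNneq qM => <-.
    case/connectP: cpy => r; elim/last_ind: r y {eym1 yM} => [|r z IHr] y /=.
      by move=> _ ->.
    rewrite rcons_path last_rcons => /andP[pr ez] ->.
    move: (ez) => /and3P[elz lM zM].
    have clast : connect (avoid M) p (last p r) by apply/connectP; exists r.
    apply: (avoid_step (IHr _ pr erefl)) => //; rewrite inE.
      by apply: contraNneq npq => <-.
    by apply: contraNneq npq => <-; apply: connect_trans clast (connect1 ez).
  by rewrite !inE !eqxx orbT => /(_ isT isT) pm1; rewrite pm1 m1M in pM.
exists (p |: (q |: M)); set M' := p |: _.
have sMM' : M \subset M' by apply/subsetP => z zM; rewrite !inE zM !orbT.
split=> //; first by rewrite !inE eqxx.
  by rewrite addn2 !cardsU1; case: (_ \notin _); case: (_ \notin _); rewrite /=; lia.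
move=> x xM'.
have xM : x \notin M by apply: contraNN xM' => /(subsetP sMM').
have [cpx|ncpx] := boolP (connect (avoid M) p x).
  have att_in m : m \in attach M' x -> m != q -> m \in [:: p; m1; m2].
    case/attachP => mM' [y cxy eym] mq; rewrite !inE.
    move: mM'; rewrite !inE (negPf mq) /= => /orP[->//|mM].
    have : m \in attach M p.
      apply/attachP; split=> //; exists y => //.
      by apply: connect_trans cpx (avoid_sub sMM' cxy).
    by move/(subsetP sub_att); rewrite !inE => ->; rewrite orbT.
  (* Two attachments other than [q] are joined through the component of [x], which avoids [q]; hence
     they coincide. *)
  have le1 : #|attach M' x :\ q| <= 1.
    apply: card_le1_set => m m'; rewrite !in_setD1.
    case/andP=> mq ma /andP[m'q m'a]; apply: sep_q; [exact: att_in..|].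
    case/attachP: ma => _ [y cxy eym]; case/attachP: m'a => _ [y' cxy' ey'm'].
    have qM' : [set q] \subset M' by rewrite sub1set !inE eqxx orbT.
    have outq z : z \notin M' -> z \notin [set q].
      by apply: contraNN => /(subsetP qM').
    have yq := outq _ (avoid_notin cxy xM'); have y'q := outq _ (avoid_notin cxy' xM').
    apply: (@connect_trans _ _ x).
      by rewrite avoid_sym; apply: avoid_step (avoid_sub qM' cxy) eym yq _; rewrite inE.
    by apply: avoid_step (avoid_sub qM' cxy') ey'm' y'q _; rewrite inE.
  by rewrite (cardsD1 q); case: (q \in _) => /=; lia.
(* New nodes lie in the old component of [p], so a component elsewhere gains no attachment. *)
apply: leq_trans (thinM x xM); apply/subset_leq_card/subsetP => m.
case/attachP => mM' [y cxy eym]; have cMxy := avoid_sub sMM' cxy.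
have yM := avoid_notin cMxy xM.
have [mM|mM] := boolP (m \in M); first by apply/attachP; split=> //; exists y.
case/negP: ncpx.
have cxm := avoid_step cMxy eym yM mM.
move: mM'; rewrite !inE (negPf mM) orbF => /orP[]/eqP def_m; rewrite def_m in mM cxm.
  by rewrite avoid_sym.
by apply: connect_trans (qK mM) _; rewrite avoid_sym.
Qed.

Lemma exists_thin (M0 : {set T}) : 0 < #|T| ->
  exists M, [/\ M0 \subset M, #|M| <= 2 * #|M0| & thin M].
Proof.
move=> T0; elim: {M0}_.+1 {-2}M0 (ltnSn #|M0|) => // n IHn M0 leM0.
have [->|[p pM0]] := set_0Vmem M0.
  exists set0; split; rewrite ?sub0set ?cards0 // => x _.
  rewrite (_ : attach _ _ = set0) ?cards0 //.
  by apply/setP => y; rewrite !inE.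
have [|M [sM0M leM thinM]] := IHn (M0 :\ p).
  by move: leM0; rewrite (cardsD1 p M0) pM0.
have [M' [sMM' pM' leM' thinM']] := @thin_add M p T0 thinM.
exists M'; split=> //; last by rewrite (cardsD1 p M0) pM0; lia.
apply/subsetP => z zM0; have [->//|zp] := eqVneq z p.
by apply/(subsetP sMM')/(subsetP sM0M); rewrite !inE zp.
Qed.

End Trees.

(** * Separators from a tree decomposition *)

(** Take for [U] the union of the bags over a thin set of nodes meeting a bag of each vertex of [N].
    A component of G - U lives in one component of the remaining tree, so its neighbours fit into
    two bags. *)
Lemma td_separator (G T : sgraph) (B : T -> {set G}) b (N : {set G}) :
  is_tree_decomposition B -> (forall t, #|B t| <= b) ->
  exists U : {set G}, [/\ N \subset U, #|U| <= 2 * #|N| * b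
    & forall x, x \notin U -> #|attach U x| <= 2 * b].
Proof.
case=> -[T0 connT acycT] covB edgeB treeB leB.
pose top v := xchoose (covB v); have topP v : v \in B (top v) := xchooseP (covB v).
have [M [sM leM thinM]] := exists_thin connT acycT (top @: N) T0.
pose U := \bigcup_(t in M) B t; have inU t z : t \in M -> z \in B t -> z \in U.
  by move=> tM zt; apply/bigcupP; exists t.
exists U; split.
- by apply/subsetP => z zN; apply: (inU (top z)) => //; apply/(subsetP sM)/imset_f.
- apply: leq_trans (card_bigcup_le _) _ => [t _|]; first exact: leB.
  by rewrite leq_mul2r (leq_trans leM) ?orbT // leq_mul2l leq_imset_card.
move=> x xU.
have notM z t : z \notin U -> z \in B t -> t \notin M.
  by move=> zU zt; apply: contraNN zU => /inU; apply.
have bags z s t : z \notin U -> z \in B s -> z \in B t -> connect (avoid M) s t.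
  move=> zU zs zt; apply: connect_sub (treeB z s t zs zt) => s' t' /= /and3P[e zs' zt'].
  by apply: connect1; rewrite /avoid /= e !(notM z).
(* Consecutive vertices of a path share a bag, and the bags of a vertex outside [U] are linked
   without meeting [M]. *)
have reach y : connect (avoid U) x y ->
    forall t, y \in B t -> connect (avoid M) (top x) t.
  case/connectP => p; elim/last_ind: p y => [|p z IHp] y /=.
    by move=> _ -> t; apply: bags.
  rewrite rcons_path last_rcons => /andP[pp /and3P[e lU zU]] -> t zt.
  have [s /andP[ls zs]] := edgeB _ _ e.
  by apply: connect_trans (IHp _ pp erefl s ls) (bags z _ _ zU zs zt).
apply: (@leq_trans #|\bigcup_(t in attach M (top x)) B t|); last first.
  apply: leq_trans (card_bigcup_le _) _ => [t _|]; first exact: leB.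
  by rewrite leq_mul2r thinM ?orbT // (notM x).
apply/subset_leq_card/subsetP => u /attachP[/bigcupP[m mM um] [y cxy eyu]].
have [s /andP[ys us]] := edgeB _ _ eyu.
have sM' : s \notin M by apply: notM ys; apply: avoid_notin cxy xU.
(* Following the bags of [u] from [s] towards [m], the first node in [M] still contains [u] and is
   an attachment. *)
have [t [t' [cst /and3P[ett' _ ut'] _ t'M]]] :=
  connect_first_entry (treeB u s m us um) sM' mM.
apply/bigcupP; exists t' => //; apply/attachP; split=> //; exists t => //.
apply: connect_trans (reach y cxy s ys) _; apply: connect_sub cst => a b'.
by move=> /= /and3P[/and3P[eab _ _] aM bM]; apply: connect1; rewrite /avoid /= eab aM bM.
Qed.

(** * Dirichlet energy and effective resistance *)

Section Energy.
Local Open Scope ring_scope.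
Variables (R : realType) (G : sgraph).
Implicit Types (f g : G -> R) (u v : G).

(** The sum over ordered pairs meets each edge twice, hence the division by 2. *)
Definition energy f : R :=
  (\sum_x \sum_y (edge x y)%:R * (f x - f y) ^+ 2) / 2.

Definition fun_vec f : 'cV[R]_#|G| := \col_i f (enum_val i).

Definition vec_fun (x : 'cV[R]_#|G|) v : R := x (enum_rank v) 0.

Lemma vec_funK x : fun_vec (vec_fun x) = x.
Proof. by apply/colP => i; rewrite mxE /vec_fun enum_valK. Qed.

Lemma energy_ge0 f : 0 <= energy f.
Proof.
rewrite divr_ge0 // sumr_ge0 // => x _; apply: sumr_ge0 => y _.
by rewrite mulr_ge0 ?sqr_ge0.
Qed.

Lemma laplacianE f :
  energy f = ((fun_vec f)^T *m laplacian R G *m fun_vec f) 0 0.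
Proof.
have -> : ((fun_vec f)^T *m laplacian R G *m fun_vec f) 0 0 =
    \sum_x \sum_y (edge x y)%:R * (f x ^+ 2 - f x * f y).
  rewrite -mulmxA mxE (reindex enum_rank) /=; last first.
    by exists enum_val => x _; rewrite ?enum_rankK ?enum_valK.
  apply: eq_bigr => x _; rewrite !mxE enum_rankK (reindex enum_rank) /=; last first.
    by exists enum_val => y _; rewrite ?enum_rankK ?enum_valK.
  under eq_bigr => y _ do rewrite !mxE !enum_rankK (inj_eq enum_rank_inj) mulrBl.
  rewrite sumrB (bigD1 x) //= eqxx mulr1n big1 ?addr0 => [|y /negPf yx]; last first.
    by rewrite eq_sym yx mulr0n mul0r.
  under [RHS]eq_bigr => y _ do rewrite mulrBr.
  rewrite sumrB mulrBr -mulr_suml; congr (_ - _).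
    rewrite mulrCA -expr2; congr (_ * _).
    by rewrite -natr_sum /degree -sum1dep_card big_mkcond /=; congr (_%:R); apply: eq_bigr => y _; case: edge.
  by rewrite mulr_sumr; apply: eq_bigr => y _; ring.
(* Symmetrise: twice the right side is its sum with the copy where [x] and [y] are exchanged. *)
apply: (mulIf (x := 2)); first by rewrite pnatr_eq0.
rewrite /energy divfK ?pnatr_eq0 // mulrDr mulr1 [X in _ = _ + X]exchange_big /= -big_split /=.
apply: eq_bigr => x _; rewrite -big_split /=; apply: eq_bigr => y _.
by rewrite [edge y x]edge_sym; ring.
Qed.

Lemma laplacian_sym : (laplacian R G)^T = laplacian R G.
Proof.
apply/matrixP => i j; rewrite !mxE edge_sym eq_sym.
by case: eqVneq => // ->.
Qed.

Lemma energy0_connect f u v : energy f = 0 -> connect (@edge G) u v -> f u = f v.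
Proof.
move=> E0 cuv; suff /eqP : v \in [pred x | f u == f x] by [].
apply: (connect_closed _ cuv); last by rewrite inE.
move=> x y exy; rewrite !inE => /eqP->.
move: E0 => /eqP; rewrite mulf_eq0 invr_eq0 pnatr_eq0 orbF => /eqP.
have F_ge0 a b : 0 <= (edge a b)%:R * (f a - f b) ^+ 2 by rewrite mulr_ge0 ?sqr_ge0.
move=> /psumr_eq0P E0; have {E0} E0 := E0 (fun a _ => sumr_ge0 _ (fun b _ => F_ge0 a b)) x isT.
have := psumr_eq0P (fun b _ => F_ge0 x b) E0 (isT : xpredT y).
by rewrite exy mul1r => /eqP; rewrite sqrf_eq0 subr_eq0.
Qed.

Lemma mul_indicatorB f u v :
  ((fun_vec f)^T *m (indicator R u - indicator R v)) 0 0 = f u - f v.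
Proof.
have mul_ind w : ((fun_vec f)^T *m indicator R w) 0 0 = f w.
  rewrite mxE (bigD1 (enum_rank w)) //= big1 ?addr0 => [|i /negPf iw].
    by rewrite !mxE !eqxx enum_rankK mulr1.
  by rewrite !mxE iw mulr0.
by rewrite mulmxBr -!mul_ind mxE [X in _ + X]mxE.
Qed.

(* The residual y = b - L L^+ b lies in the kernel of L, hence is constant
   along the component of u and v, so |y|^2 = <y, b> = y u - y v = 0. *)
Lemma laplacian_mpinv_indicator u v : connect (@edge G) u v ->
  laplacian R G *m mpinv (laplacian R G) *m (indicator R u - indicator R v) =
  indicator R u - indicator R v.
Proof.
move=> cuv; set L := laplacian R G; set b := _ - _.
have /and4P[/eqP P1 _ /eqP P3 _] := mpinvP L; set P := L *m mpinv L in P3 *.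
(* [P] is the orthogonal projection onto the range of [L]. *)
have PL : P *m L = L by rewrite /P P1.
have LP : L *m P = L.
  have symL : L^T = L := laplacian_sym.
  by rewrite -{1}symL -P3 -trmx_mul PL symL.
have PP : P *m P = P by rewrite {2}/P mulmxA PL.
pose y := b - P *m b.
have Ly : L *m y = 0 by rewrite mulmxBr mulmxA LP subrr.
have Py : P *m y = 0 by rewrite mulmxBr mulmxA PP subrr.
have yy : (y^T *m y) 0 0 = 0.
  have -> : y^T *m y = y^T *m b.
    by rewrite {2}/y mulmxBr mulmxA -P3 -trmx_mul Py trmx0 mul0mx subr0.
  rewrite -(vec_funK y) mul_indicatorB; apply/eqP; rewrite subr_eq0; apply/eqP.
  by apply: energy0_connect => //; rewrite laplacianE vec_funK -mulmxA Ly mulmx0 mxE.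
suff y0 : y = 0 by apply/esym/eqP; rewrite -subr_eq0 -/y y0.
apply/colP => i; rewrite [RHS]mxE; move: yy; rewrite mxE => yy.
have F_ge0 j : 0 <= y^T 0 j * y j 0 by rewrite mxE -expr2 sqr_ge0.
have /eqP := psumr_eq0P (fun j _ => F_ge0 j) yy (i := i) isT.
by rewrite [y^T _ _]mxE -expr2 sqrf_eq0 => /eqP.
Qed.

(** This expands the nonnegative energy of [f - c x], where [x] is the potential of a unit current
    from [u] to [v]. A free [c] avoids dividing by the resistance, which is 0 for [u = v]. *)
Lemma energy_eff_res f u v c : connect (@edge G) u v ->
  2 * c * (f u - f v) - c ^+ 2 * eff_res R u v <= energy f.
Proof.
move=> cuv; set L := laplacian R G; set b := indicator R u - indicator R v.
pose x := mpinv L *m b.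
have Lx : L *m x = b by rewrite /x mulmxA laplacian_mpinv_indicator.
have xb : (x^T *m b) 0 0 = eff_res R u v.
  by rewrite -[b in x^T *m b]trmxK -trmx_mul mxE /x mulmxA.
have xLf : x^T *m L *m fun_vec f = ((fun_vec f)^T *m b)^T.
  by rewrite [RHS]trmx_mul trmxK -Lx [in RHS]trmx_mul laplacian_sym.
have := energy_ge0 (vec_fun (fun_vec f - c *: x)); rewrite laplacianE vec_funK -/L.
have -> : ((fun_vec f - c *: x)^T *m L *m (fun_vec f - c *: x)) 0 0 =
    energy f - 2 * c * (f u - f v) + c ^+ 2 * eff_res R u v.
  have -> : (fun_vec f - c *: x)^T = (fun_vec f)^T - c *: x^T.
    by apply/rowP => i; rewrite !mxE.
  rewrite !mulmxBl !mulmxBr -!scalemxAl -!scalemxAr.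
  rewrite -[_ *m L *m x]mulmxA Lx xLf -[x^T *m L *m x]mulmxA Lx laplacianE -/L.
  rewrite -(mul_indicatorB f u v) -/b -xb.
  move: ((fun_vec f)^T *m b) (x^T *m b) (_ *m fun_vec f) => m1 m2 m3.
  by rewrite !mxE; ring.
by move=> h; lra.
Qed.

End Energy.

(** * Nested edge cuts around the ball *)

(** With m = 2bd, the base is the loss per level when the inner boundary has at most m vertices, and
    the exponent m + 1 is the number of levels. *)
Definition density_bound (b d : nat) : nat :=
  (2 * (2 * b * d) * b * (1 + d)) ^ (2 * b * d).+1.

Section Growth.
Variables (G : sgraph) (d b : nat).
Hypothesis deg_le : forall v : G, degree v <= d.
Hypothesis sepG : forall N : {set G}, exists U : {set G},
  [/\ N \subset U, #|U| <= 2 * #|N| * b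
    & forall x, x \notin U -> #|attach U x| <= 2 * b].

(** Cut edges are oriented outwards: each counts once, and the first components form the inner
    boundary. *)
Definition boundary (A : {set G}) : {set G * G} :=
  [set p | [&& edge p.1 p.2, p.1 \in A & p.2 \notin A]].

(* One level of the nested cuts: off N, the region A stays away from v and from
   its own outer boundary, so the cut around A' is edge-disjoint from that of A. *)
Lemma shrink_region (v : G) (S A N : {set G}) n :
  (forall x, x \in A -> connect (@edge G) x v) ->
  (forall x, x \in A -> x \notin N -> x != v /\ forall y, edge x y -> y \in A) ->
  0 < n -> 2 * #|N| * b * (1 + d) * n < #|S :&: A| ->
  exists A' : {set G}, [/\ A' \subset A, n < #|S :&: A'|,
    #|boundary A'| <= 2 * b * d
    & forall x, x \in A' -> x != v /\ forall y, edge x y -> y \in A].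
Proof.
move=> connA intA n_gt0 ltS; have [U [sNU leU thinU]] := sepG N.
have notN x : x \notin U -> x \notin N by apply: contraNN => /(subsetP sNU).
(* Only vertices of [N], hence of [U], have edges leaving [A]. *)
have compA x : x \in A -> x \notin U -> forall y, y \in comp U x -> (y \in A) && (y \notin U).
  move=> xA xU y; rewrite inE => cxy.
  apply: (connect_closed (P := [pred z | (z \in A) && (z \notin U)]) _ cxy).
    move=> s t /and3P[est _ tU] /andP[sA sU]; rewrite inE tU andbT.
    by have [_] := intA s sA (notN s sU); apply.
  by rewrite inE xA xU.
pose big y := [&& y \in A, y \notin U & n < #|S :&: comp U y|].
have [y /and3P[yA yU big_y]|small] := pickP big; last first.
  (* If all components are poor, [S :&: A] is covered by [U] and by at most [#|U| * d] components,
     each with at most [n] points of [S]. *)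
  suff : #|S :&: A| <= 2 * #|N| * b * (1 + d) * n by rewrite leqNgt ltS.
  pose near := \bigcup_(u in U) [set y | edge u y].
  pose F y := if (y \in A) && (y \notin U) then S :&: comp U y else set0.
  have subF : S :&: A \subset U :|: \bigcup_(y in near) F y.
    apply/subsetP => x; rewrite !inE => /andP[xS xA].
    have [//|xU /=] := boolP (x \in U).
    have vNx : v \in ~: comp U x.
      rewrite in_setC; apply/negP => /(compA x xA xU)/andP[vA vU].
      by have [] := intA v vA (notN v vU); rewrite eqxx.
    have xx : x \notin ~: comp U x by rewrite in_setC negbK inE connect0.
    (* A path to [v] must leave the component of [x], and it does so into [U]; hence that component
       contains a neighbour of [U]. *)
    have [y [z [_ eyz]]] := connect_first_entry (connA x xA) xx vNx.
    rewrite !in_setC negbK => yx zx; have /andP[yA yU] := compA x xA xU y yx.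
    have zU : z \in U.
      apply: contraNT zx; rewrite !inE in yx *; exact: avoid_step yx eyz yU.
    apply/bigcupP; exists y.
      by apply/bigcupP; exists z => //; rewrite inE edge_sym.
    by rewrite /F yA yU !inE xS /= avoid_sym; move: yx; rewrite inE.
  have leNear : #|near| <= #|U| * d.
    by apply: card_bigcup_le => u _; apply: deg_le.
  have leF : #|\bigcup_(y in near) F y| <= #|near| * n.
    apply: card_bigcup_le => y _; rewrite /F.
    case: ifP => [/andP[yA yU]|_]; last by rewrite cards0.
    by have := small y; rewrite /big yA yU ltnNge => /negbFE.
  apply: leq_trans (subset_leq_card subF) _; apply: leq_trans (leq_card_setU _ _) _.
  have : #|near| * n <= #|U| * d * n by rewrite leq_mul2r leNear orbT.
  have : #|U| <= #|U| * n by rewrite leq_pmulr.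
  have : #|U| * ((1 + d) * n) <= 2 * #|N| * b * ((1 + d) * n).
    by rewrite leq_mul2r leU orbT.
  by move: leF; nia.
exists (comp U y); split=> //.
- by apply/subsetP => x /(compA y yA yU)/andP[].
(* Boundary edges end in the at most 2b attachments, each of degree at most [d]. *)
- have sub_bd : boundary (comp U y) \subset
      \bigcup_(u in attach U y) [set (x, u) | x in [set x | edge u x]].
    apply/subsetP => -[x u]; rewrite inE /= => /and3P[exu xy uy].
    have /andP[xA xU] := compA y yA yU x xy; rewrite inE in xy.
    have uU : u \in U.
      by apply: contraNT uy => uU; rewrite inE; apply: avoid_step xy exu xU uU.
    apply/bigcupP; exists u; first by apply/attachP; split=> //; exists x.
    by apply: imset_f; rewrite inE edge_sym.
  apply: leq_trans (subset_leq_card sub_bd) _.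
  apply: leq_trans (card_bigcup_le (n := d) _) _ => [u _|].
    exact: leq_trans (leq_imset_card _ _) (deg_le u).
  by rewrite leq_mul2r thinU ?orbT.
- by move=> x /(compA y yA yU)/andP[xA xU]; apply: intA (notN x xU).
Qed.

(** On edges meeting [A'] the function [f] is constant, so the energy grows from 0 to 1 exactly on
    the cut edges; all other edges keep theirs. *)
Lemma energy_add_indicator (R : realType) (f : G -> R) (A A' : {set G}) (c : R) :
  (forall x, x \in A -> f x = c) ->
  (forall x, x \in A' -> x \in A /\ forall y, edge x y -> y \in A) ->
  (energy (fun x => f x + (x \in A')%:R) <= energy f + #|boundary A'|%:R)%R.
Proof.
move=> fA intA'; pose bd x y := [&& edge x y, x \in A' & y \notin A'].
have card_bd : (#|boundary A'|%:R = \sum_x \sum_y (bd x y)%:R :> R)%R.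
  rewrite pair_big /= -natr_sum -sum1_card big_mkcond /=; congr (_%:R)%R.
  by apply: eq_bigr => -[x y] _ /=; rewrite inE /= -/(bd x y); case: (bd x y).
have card_bd' : (#|boundary A'|%:R = \sum_x \sum_y (bd y x)%:R :> R)%R.
  by rewrite card_bd exchange_big.
suff : (\sum_x \sum_y (edge x y)%:R * (f x + (x \in A')%:R - (f y + (y \in A')%:R)) ^+ 2
    <= \sum_x \sum_y (edge x y)%:R * (f x - f y) ^+ 2
       + #|boundary A'|%:R + #|boundary A'|%:R :> R)%R.
  by rewrite /energy; lra.
rewrite {1}card_bd card_bd' -!big_split /=; apply: ler_sum => x _.
rewrite -!big_split /=; apply: ler_sum => y _; rewrite /bd [edge y x]edge_sym.
case exy: (edge x y); rewrite ?mul0r ?addr0 ?mul1r //=.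
have [xA|_] := boolP (x \in A'); have [yA|_] := boolP (y \in A') => /=.
- by lra.
- by have [/fA-> /(_ y exy)/fA->] := intA' x xA; lra.
- have [/fA-> /(_ x)] := intA' y yA; rewrite edge_sym => /(_ exy)/fA->.
  by lra.
- by lra.
Qed.

Lemma card_er_ball_le (R : realType) (v : G) : 0 < b -> 0 < d ->
  #|er_ball R v| <= density_bound b d.
Proof.
rewrite /density_bound => b_gt0 d_gt0; set m := 2 * b * d; set Q := _ * (1 + d); set S := er_ball R v.
rewrite leqNgt; apply/negP => ltS.
have Q_gt0 : 0 < Q by rewrite /Q /m !muln_gt0 b_gt0 d_gt0.
(* [f] counts the cuts crossed so far, [A] is the region behind the last one and [N] its inner
   boundary. Each level divides the guaranteed number of ball vertices by [Q]. *)
have levels k : k <= m.+1 -> exists (f : G -> R) (A N : {set G}),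
  [/\ f v = 0%R /\ forall x, x \in A -> f x = (k%:R)%R,
      (energy f <= (m * k)%:R)%R, #|N| <= m /\ Q ^ (m.+1 - k) < #|S :&: A|,
      forall x, x \in A -> connect (@edge G) x v
    & forall x, x \in A -> x \notin N -> x != v /\ forall y, edge x y -> y \in A].
  elim: k => [|k IHk] lek.
    (* At level 0 no cut exists yet; [N] is [v] alone, which keeps [v] out of all later regions. *)
    exists (fun=> 0%R), [set x | connect (@edge G) x v], [set v]; split.
    - by [].
    - rewrite muln0 /energy big1 ?mul0r // => x _; rewrite big1 // => y _.
      by rewrite subrr expr0n mulr0.
    - rewrite cards1 subn0 (_ : S :&: _ = S) ?ltS; last first.
        by apply/setIidPl/subsetP => x; rewrite !inE => /andP[].
      by split=> //; rewrite /m !muln_gt0 b_gt0 d_gt0.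
    - by move=> x; rewrite inE.
    - move=> x; rewrite !inE => cxv xv; split=> // y exy; rewrite inE.
      by apply: connect_trans cxv; apply: connect1; rewrite edge_sym.
  have [f [A [N [[fv fA] leE [leN ltA] connA intA]]]] := IHk (ltnW lek).
  have [||A' [sA' ltA' leB intA']] := @shrink_region v S A N (Q ^ (m.+1 - k.+1)) connA intA.
  - by rewrite expn_gt0 Q_gt0.
  - apply: leq_ltn_trans ltA; rewrite -[m.+1 - k]prednK ?subn_gt0 // expnS -subnS.
    by rewrite leq_mul2r /Q !leq_mul2r leq_mul2l leN !orbT.
  exists (fun x => f x + (x \in A')%:R)%R, A', [set p.1 | p in boundary A']; split.
  - split=> [|x xA']; last by rewrite xA' fA ?(subsetP sA') // -natr1.
    rewrite fv add0r; have [/intA'[]|//] := boolP (v \in A').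
    by rewrite eqxx.
  - apply: le_trans (energy_add_indicator (A := A) fA _) _ => [x xA'|].
      by split; [exact: (subsetP sA') | case: (intA' x xA')].
    by rewrite mulnS natrD addrC lerD // ler_nat.
  - by split=> //; apply: leq_trans (leq_imset_card _ _) leB.
  - by move=> x /(subsetP sA')/connA.
  - move=> x xA' xN; have [xv _] := intA' x xA'; split=> // y exy.
    apply: contraNT xN => yA'; apply/imsetP; exists (x, y) => //.
    by rewrite inE /= exy xA'.
have [f [A [N [[fv fA] leE [_]]]]] := levels m.+1 (leqnn _).
rewrite subnn expn0 => /ltnW/card_gt0P[u]; rewrite !inE => /andP[/andP[cuv leR] uA] _ _.
(* With [c] = m + 1 equal to the potential drop, R(u, v) at most 1 would give (m + 1)^2 at most m (m
   + 1). *)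
have := energy_eff_res f (m.+1%:R)%R cuv; rewrite fv fA // subr0 => leE'.
have : (m.+1%:R ^+ 2 <= (m * m.+1)%:R :> R)%R.
  have : (m.+1%:R ^+ 2 * eff_res R u v <= m.+1%:R ^+ 2 :> R)%R.
    by rewrite ler_piMr // sqr_ge0.
  by move: leE leE' => /=; lra.
by rewrite -natrX ler_nat expnS expn1 leq_mul2r /= ltnn.
Qed.

End Growth.

(** * Edgeless graphs and the final bounds *)

Lemma edgeless_er_ball (R : realType) (G : sgraph) (v : G) :
  (forall x y : G, ~~ edge x y) -> #|er_ball R v| <= 1.
Proof.
move=> noE; rewrite -(cards1 v) subset_leq_card //; apply/subsetP => u.
rewrite !inE => /andP[/connectP[[|x p] /=]]; first by move=> _ ->.
by rewrite (negPf (noE _ _)).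
Qed.

Lemma treewidth_bags (G : sgraph) : exists (T : sgraph) (B : T -> {set G}),
  is_tree_decomposition B /\ forall t, #|B t| <= (treewidth G).+1.
Proof.
rewrite /treewidth; case: ex_minnP => w /asboolP[T [B [tdB <-]]] _.
exists T, B; split=> // t; rewrite /td_width.
by apply: leq_trans (leqSpred _); apply: (leq_bigmax (F := fun t => #|B t|)).
Qed.

Lemma degree_le_max (G : sgraph) (v : G) : degree v <= max_degree G.
Proof. exact: (leq_bigmax (F := @degree G)). Qed.

Lemma edge_max_degree_gt0 (G : sgraph) (x y : G) : edge x y -> 0 < max_degree G.
Proof.
move=> exy; apply: leq_trans (degree_le_max x).
by apply/card_gt0P; exists y; rewrite inE.
Qed.

Lemma edge_treewidth_gt0 (G : sgraph) (x y : G) : edge x y -> 0 < treewidth G.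
Proof.
move=> exy; have [T [B [[_ _ edgeB _] leB]]] := treewidth_bags G.
have [t /andP[xt yt]] := edgeB x y exy; rewrite -ltnS; apply: leq_trans (leB t).
have xy : x != y by apply: contraTneq exy => ->; rewrite edge_irr.
have <- : #|[set x; y]| = 2 by rewrite cards2 xy.
by apply/subset_leq_card/subsetP => z; rewrite !inE => /orP[]/eqP->.
Qed.

Lemma er_density_le (R : realType) (G : sgraph) :
  0 < max_degree G ->
  er_density R G <= density_bound (treewidth G).+1 (max_degree G).
Proof.
move=> d_gt0; apply/bigmax_leqP => v _; have [T [B [tdB leB]]] := treewidth_bags G.
by apply: card_er_ball_le => //; [exact: degree_le_max | move=> N; exact: td_separator tdB leB].
Qed.

Lemma edgeless_er_density (R : realType) (G : sgraph) :
  (forall x y : G, ~~ edge x y) -> er_density R G <= 1.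
Proof. by move=> noE; apply/bigmax_leqP => v _; apply: edgeless_er_ball. Qed.

(** With D = w d at least 2, the base is at most 32 D^2, hence at most D^7, and the exponent is at
    most 4D + 1, hence at most 5D. This yields 35 = 7 * 5. *)
Lemma density_bound_le_exp (w d : nat) : 1 < w * d ->
  density_bound w.+1 d <= (w * d) ^ (35 * (w * d ^ 3)).
Proof.
move=> D_gt1; have /andP[w_gt0 d_gt0] : (0 < w) && (0 < d) by rewrite -muln_gt0 ltnW.
rewrite /density_bound; set m := 2 * w.+1 * d; set D := w * d in D_gt1 *.
have le_m : m <= 4 * D by rewrite /m /D; nia.
have le_Q : 2 * m * w.+1 * (1 + d) <= 32 * D ^ 2.
  have : w.+1 * (1 + d) <= 4 * D by rewrite /D; nia.
  by rewrite expnS expn1; nia.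
have le_Q' : 32 * D ^ 2 <= D ^ 7.
  by rewrite -[7]/(5 + 2) expnD leq_mul2r (leq_exp2r 2 D (isT : 0 < 5)) D_gt1 orbT.
apply: (@leq_trans ((D ^ 7) ^ m.+1)).
  by rewrite leq_exp2r // (leq_trans le_Q).
rewrite -expnM leq_exp2l //.
have : D <= w * d ^ 3 by rewrite /D leq_mul2l -{1}[d]expn1 leq_pexp2l ?orbT.
by nia.
Qed.

Lemma density_bound_mono (b d b' d' : nat) :
  0 < b -> 0 < d -> b <= b' -> d <= d' -> density_bound b d <= density_bound b' d'.
Proof.
move=> b_gt0 d_gt0 leb led; rewrite /density_bound.
set m := 2 * b * d; set m' := 2 * b' * d'.
have lem : m <= m' by rewrite !leq_mul.
apply: (@leq_trans ((2 * m' * b' * (1 + d')) ^ m.+1)).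
  by rewrite leq_exp2r // !leq_mul.
by rewrite leq_pexp2l // !muln_gt0 /= (leq_trans b_gt0 leb) (leq_trans d_gt0 led).
Qed.

(** The product 1 is excluded because powers of 1 are 1, whereas a single edge has density 2. *)
Theorem mainTheorem7 (R : realType) :
  (exists C : nat, forall G : sgraph,
     (treewidth G * max_degree G != 1)%N ->
     (er_density R G <=
        (treewidth G * max_degree G)
          ^ (C * (treewidth G * max_degree G ^ 3)))%N)
  /\
  (forall d w : nat, exists K : nat, forall G : sgraph,
     (max_degree G <= d)%N -> (treewidth G <= w)%N -> (er_density R G <= K)%N).
Proof.
split=> [|d w].
  exists 35 => G neq1; have [D0|D_gt0] := posnP (treewidth G * max_degree G).
    (* A zero product makes the exponent 0 as well, so the bound is 1; an edge would make both
       factors positive. *)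
    rewrite expnS [treewidth G * (_ * _)]mulnA D0 mul0n muln0 expn0; apply: edgeless_er_density => x y.
    apply/negP => exy; move/eqP: D0; rewrite muln_eq0.
    by rewrite !gtn_eqF ?(edge_max_degree_gt0 exy) ?(edge_treewidth_gt0 exy).
  have D_gt1 : 1 < treewidth G * max_degree G by rewrite ltn_neqAle eq_sym neq1.
  apply: leq_trans (density_bound_le_exp D_gt1); apply: er_density_le.
  by move: D_gt0; rewrite muln_gt0 => /andP[].
(* The successor covers edgeless graphs: [density_bound] vanishes at [d = 0], but one vertex already
   has density 1. *)
exists (density_bound w.+1 d).+1 => G led lew.
have [d0|d_gt0] := posnP (max_degree G).
  apply: leq_trans (_ : 1 <= _) => //; apply: edgeless_er_density => x y.
  by apply/negP => /edge_max_degree_gt0; rewrite d0.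
by apply/leqW/(leq_trans (er_density_le R d_gt0))/density_bound_mono.
Qed.
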